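(* (i) Let $n\in\mathbb{N}$, let $P$ be any probability distribution on $S=[n]=\{1,2,\ldots,n\}$, and let $t\in\mathbb{N}$, $t\ge 1$. Then $$\mathbb{E}[U_t]\le \begin{cases} e^{-t/n}, & t\le n,\\[2pt] \dfrac{n}{et}, & t>n.\end{cases}$$ (ii) There is a universal constant $c>0$ such that for every probability distribution $P$ on $S=\mathbb{N}$ and every integer $t\ge 1$, $$\mathbb{E}[U_t]\le \frac{\ell(P)}{ct},$$ where $\ell(P)\in\{0,1,2,\ldots\}\cup\{\infty\}$ is the plateau length of $P$ (the bound being vacuous when $\ell(P)=\infty$).
   Context: Let $S$ be a countable set with a probability measure $P$, and write $p_s=P(\{s\})$. Let $X_1,\ldots,X_t$ be drawn independently from $S$ according to $P$. The missing mass is the random variable $U_t=P(S\setminus\{X_1,\ldots,X_t\})$; its expectation is $\mathbb{E}[U_t]=\sum_{s\in S}p_s(1-p_s)^t$. For a probability distribution $P$ over $\mathbb{N}=\{1,2,\ldots\}$ with $p_i=P(\{i\})$, the plateau length is $$\ell(P)=\sup_{0<\alpha<1}\bigl|\{i\in\mathbb{N}:\alpha/2\le p_i<\alpha\}\bigr|,$$ which may equal $\infty$. *)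

(* Defs.v *)
From HB Require Import structures.
From mathcomp Require Import all_boot all_order all_algebra.
From mathcomp Require Import all_classical all_reals all_analysis.

Set Implicit Arguments.
Unset Strict Implicit.
Unset Printing Implicit Defensive.

Import Order.TTheory GRing.Theory Num.Theory.
Import numFieldNormedType.Exports.

Local Open Scope classical_set_scope.
Local Open Scope ring_scope.

(* The library equips nat, but not the ordinals, with the discrete
   sigma-algebra. Measurable types are pointed, hence the successor. *)
HB.instance Definition _ (n : nat) := isPointed.Build 'I_n.+1 ord0.
HB.instance Definition _ (n : nat) :=
  @isMeasurable.Build default_measure_display 'I_n.+1 discrete_measurable
    discrete_measurable0 discrete_measurableC discrete_measurableU.

(* The product rule over every subfamily J. *)
Definition mutually_independent (d d' : measure_display)
    (Omega : measurableType d) (S : measurableType d') (R : realType)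
    (mu : probability Omega R) (I : finType) (X : I -> {RV mu >-> S}) : Prop :=
  forall (J : {set I}) (A : I -> set S), (forall i, measurable (A i)) ->
    mu (\bigcap_(i in [set` J]) (X i @^-1` A i)) =
    (\prod_(i in J) mu (X i @^-1` A i))%E.

Definition iid_sample (d d' : measure_display)
    (Omega : measurableType d) (S : measurableType d') (R : realType)
    (mu : probability Omega R) (P : probability S R) (t : nat)
    (X : 'I_t -> {RV mu >-> S}) : Prop :=
  mutually_independent X /\
  forall (i : 'I_t) (A : set S), measurable A -> distribution mu (X i) A = P A.

(* S is meant to be countable with the discrete sigma-algebra, so that the
   complement of the sample is measurable. *)
Definition missing_mass (d d' : measure_display)
    (Omega : measurableType d) (S : measurableType d') (R : realType)
    (mu : probability Omega R) (P : probability S R) (t : nat)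
    (X : 'I_t -> {RV mu >-> S}) (w : Omega) : R :=
  fine (P (~` [set X i w | i in [set: 'I_t]])).

(* The natural numbers are indexed from 0 instead of 1; counting A is the
   cardinality of A, with value +oo when A is infinite. *)
Definition plateau_length (R : realType) (P : probability nat R) : \bar R :=
  ereal_sup [set counting [set i : nat |
                   ((alpha / 2)%:E <= P [set i] < alpha%:E)%E]
            | alpha in [set a : R | 0 < a < 1]].

(* Main.v *)
(* By independence E[U_t] = sum_s p_s (1 - p_s)^t, and (1 - p)^t <= e^(-tp).
   (i) If t > n, each term is at most max_p p e^(-tp) = 1 / (et). If t <= n, the
   tangent at 1/n, whose slope is nonnegative, dominates p e^(-tp) on all of
   [0, 1]; averaging the tangent over p_1, ..., p_n gives e^(-t/n).
   (ii) At most l(P) of the p_s lie in [a/2, a), so with y = ta/2 this scale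
   contributes at most l(P) / t * 2 y e^(-y). Since y e^(-y) <= 7 (G(2y) - G(y))
   with G(y) = y / (1 + y) <= 1, the sum over all dyadic scales telescopes and is
   at most 14 l(P) / t. *)
Require Import Defs.
From HB Require Import structures.
From mathcomp Require Import all_boot all_order all_algebra.
From mathcomp Require Import all_classical all_reals all_analysis.
From mathcomp Require Import measurable_realfun ring lra.

Set Implicit Arguments.
Unset Strict Implicit.
Unset Printing Implicit Defensive.

Import Order.TTheory GRing.Theory Num.Theory.
Import numFieldNormedType.Exports.

Local Open Scope classical_set_scope.
Local Open Scope ring_scope.

(** * Elementary exponential inequalities *)

Lemma exprB1_le_expR (R : realType) (x : R) (t : nat) :
  x <= 1 -> (1 - x) ^+ t <= expR (- (t%:R * x)).
Proof.
move=> x1; rewrite -mulrN expRM_natl lerXn2r// ?nnegrE ?expR_ge0 ?subr_ge0//.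
exact: expR_ge1Dx.
Qed.

Lemma mul_expRN_le (R : realType) (y : R) : y * expR (- y) <= expR (- 1).
Proof.
have := expR_ge1Dx (y - 1); rewrite addrC subrK expRB => h.
rewrite expRN [leRHS]expRN ler_pdivrMr ?expR_gt0// mulrC.
exact: h.
Qed.

(* By convexity e^(s(1-u)) <= s e^(1-u) + (1-s), and u e^(1-u) <= 1. *)
Lemma mul_expRN_tangent (R : realType) (u s : R) : 0 <= u -> 0 <= s <= 1 ->
  u * expR (- (s * (u - 1))) <= 1 + (1 - s) * (u - 1).
Proof.
move=> u0 sI; have /andP[s0 s1] := sI.
have := @convex_expR R (Itv01 s0 s1) (1 - u) 0.
rewrite !convRE /= expR0 mulr0 addr0 mulr1 => convex_exp.
rewrite -mulrN opprB (le_trans (ler_wpM2l u0 convex_exp))// mulrDr mulrCA.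
have : u * expR (1 - u) <= 1.
  have := mul_expRN_le u; rewrite expRB expRN mulrCA.
  by rewrite -(ler_pM2l (expR_gt0 1)) expRN mulfV// expR_eq0.
move=> /(ler_wpM2l s0); rewrite /unstable.onem; lra.
Qed.

(** The difference is [y / ((1 + 2 * y) * (1 + y))], so it suffices that (1 + 2y)(1 + y) <= 7 e^y.
    The constant is 7 = 4 + 3: add 4 times 1 + y^2/2 <= e^y and 3 times 1 + y <= e^y. *)
Lemma mul_expRN_telescope (R : realType) (y : R) : 0 <= y ->
  y * expR (- y) <= 7 * (2 * y / (1 + 2 * y) - y / (1 + y)).
Proof.
move=> y0.
have -> : 7 * (2 * y / (1 + 2 * y) - y / (1 + y))
  = y * (7 / ((1 + 2 * y) * (1 + y))).
  by field; apply/andP; split; apply/eqP; lra.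
apply: ler_wpM2l => //; rewrite expRN -div1r.
rewrite ler_pdivlMr ?mulr_gt0//; [|lra..].
rewrite mulrAC ler_pdivrMr ?expR_gt0// mul1r.
have := @expR_ge1Dxn R y 1 y0; have := expR_ge1Dx y.
rewrite (_ : (2`!)%:R = 2)//; set e := expR y.
lra.
Qed.

(** * Bounds on finite sums of p (1 - p)^t *)

Lemma sum_missing_le (R : realType) (n t : nat) (p : 'I_n.+1 -> R) :
  (0 < t)%N -> (forall i, 0 <= p i <= 1) -> \sum_i p i = 1 ->
  \sum_i p i * (1 - p i) ^+ t <=
    if (t <= n.+1)%N then expR (- (t%:R / n.+1%:R))
    else n.+1%:R / (expR 1 * t%:R).
Proof.
move=> t0 p01 sum_p.
have term_le i : p i * (1 - p i) ^+ t <= p i * expR (- (t%:R * p i)).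
  by have /andP[p0 p1] := p01 i; rewrite ler_wpM2l// exprB1_le_expR.
have tR0 : (0 : R) < t%:R by rewrite ltr0n.
set N : R := n.+1%:R.
have N0 : 0 < N by rewrite ltr0n.
case: ifPn => [tn|_].
  set s := t%:R / N.
  have s01 : 0 <= s <= 1.
    by rewrite divr_ge0 ?ler0n//= ler_pdivrMr// mul1r ler_nat.
  (* In the variable u = N p_i one has t p_i = s u; the factor e^(-s) / N undoes the rescaling. The
     deviations N p_i - 1 sum to zero, which leaves e^(-s). *)
  have tangent i : p i * (1 - p i) ^+ t <=
      expR (- s) / N * (1 + (1 - s) * (N * p i - 1)).
    apply: le_trans (term_le i) _.
    have /andP[p0 _] := p01 i.
    have u0 : 0 <= N * p i by rewrite mulr_ge0// ltW.
    have := mul_expRN_tangent u0 s01.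
    rewrite mulrBr mulr1 opprB expRD => h.
    have -> : t%:R * p i = s * (N * p i).
      by rewrite mulrA /s divfK// gt_eqF.
    rewrite -(ler_pM2l (_ : 0 < N / expR (- s))) ?divr_gt0 ?expR_gt0//.
    rewrite [leRHS]mulrA mulf_div [in leRHS](mulrC (expR _)) divff ?mul1r.
      apply: le_trans h; rewrite le_eqVlt; apply/orP; left; apply/eqP.
      by rewrite (expRN s) invrK; ring.
    by rewrite mulf_neq0// gt_eqF// expR_gt0.
  apply: le_trans (ler_sum _ (fun i _ => tangent i)) _.
  rewrite -mulr_sumr big_split/= sumr_const card_ord -mulr_sumr sumrB.
  rewrite -mulr_sumr sum_p sumr_const card_ord mulr1 subrr mulr0 addr0.
  by rewrite mulfVK// gt_eqF.
have bound i : p i * (1 - p i) ^+ t <= (expR 1 * t%:R)^-1.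
  apply: le_trans (term_le i) _.
  have := mul_expRN_le (t%:R * p i).
  rewrite invfM -expRN => h; rewrite ler_pdivlMr// mulrAC -mulrA mulrCA.
  by rewrite mulrA.
apply: le_trans (ler_sum _ (fun i _ => bound i)) _.
by rewrite sumr_const card_ord -[leLHS]mulr_natl.
Qed.

(* G (t a) with G y = y / (1 + y) replaces a geometric series over the dyadic
   scales below a: passing from a to a / 2 costs exactly one scale. *)
Lemma dyadic_sum_le (R : realType) (I : finType) (p : I -> R) (L : R) (t : nat) :
  (0 < t)%N ->
  (forall a, 0 < a < 1 -> #|[pred i | a / 2 <= p i < a]|%:R <= L) ->
  forall a, 0 < a <= 1 ->
  \sum_(i | 0 < p i < a) p i * (1 - p i) ^+ t <=
    14 * L / t%:R * (t%:R * a / (1 + t%:R * a)).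
Proof.
move=> t0 plateau a.
have tR0 : (0 : R) < t%:R by rewrite ltr0n.
have L0 : 0 <= L.
  by apply: le_trans (plateau (1 / 2) _); rewrite ?ler0n//; lra.
have [m] := ubnP #|[pred i | 0 < p i < a]|.
elim: m a => // m IHm a card_le /andP[a0 a1].
have [i0 i0P|none] := pickP [pred i | 0 < p i < a]; last first.
  by rewrite big_pred0// !mulr_ge0 ?invr_ge0 ?addr_ge0 ?mulr_ge0// ltW.
case: (@Order.TotalTheory.arg_maxP _ _ _ i0 [pred i | 0 < p i < a] p i0P).
move=> i /= /andP[pi0 pia] pi_max.
(* The scale [b/2, b) contains the largest p i below a, so the induction on the
   number of positive p i below a goes through; also b < 1 even when a = 1. *)
have [b [pib ba b2]] : exists b, [/\ p i < b, b < a & b / 2 <= p i].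
  (* The witness is the midpoint of [p i] and min(a, 2 [p i]). *)
  have [a2|a2] := leP a (2 * p i).
    by exists ((p i + a) / 2); split; lra.
  by exists (3 / 2 * p i); split; lra.
have b0 : 0 < b by apply: lt_trans pib.
rewrite (bigID (fun j => b / 2 <= p j))/=.
set y := t%:R * (b / 2).
have y0 : 0 <= y by rewrite mulr_ge0// ltW// divr_gt0.
have top_le : \sum_(j | (0 < p j < a) && (b / 2 <= p j)) p j * (1 - p j) ^+ t
    <= L * (b * expR (- y)).
  apply: (@le_trans _ _ (\sum_(j in [pred j | b / 2 <= p j < b]) b * expR (- y))).
    (* By maximality of [p i] no value lies in [b, a), so the top part is exactly the scale [b/2,
       b), with at most [L] members. *)
    rewrite (eq_bigl (fun j => j \in [pred j | b / 2 <= p j < b])); last first.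
      move=> j; rewrite !inE; apply/idP/idP => [/andP[pj ->]/=|/andP[bj jb]].
        by apply: le_lt_trans pib; apply: pi_max.
      by rewrite bj andbT; apply/andP; split; lra.
    apply: ler_sum => j; rewrite inE => /andP[bj jb].
    apply: ler_pM; [lra|by rewrite exprn_ge0//; lra|lra|].
    apply: le_trans (exprB1_le_expR _ _) _; first lra.
    by rewrite ler_expR lerN2 /y ler_pM2l.
  rewrite sumr_const -[leLHS]mulr_natl ler_wpM2r ?plateau//.
    by rewrite mulr_ge0 ?expR_ge0// ltW.
  by rewrite b0; lra.
have bottom_le : \sum_(j | (0 < p j < a) && ~~ (b / 2 <= p j)) p j * (1 - p j) ^+ t
    <= 14 * L / t%:R * (y / (1 + y)).
  rewrite (eq_bigl (fun j => 0 < p j < b / 2)); last first.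
    move=> j; rewrite -ltNge; apply/idP/idP => [/andP[/andP[-> _] ->]//|].
    by move=> /andP[-> jb]; rewrite jb !andbT/=; lra.
  apply: IHm; last by rewrite divr_gt0//=; lra.
  (* The count drops strictly: [i] lies below [a] but not below [b / 2]. *)
  rewrite -ltnS (leq_trans _ card_le)// ltnS; apply: proper_card.
  apply/properP; split.
    by apply/fintype.subsetP => j; rewrite !inE => /andP[-> jb]/=; lra.
  by exists i; rewrite !inE ?pi0//= -leNgt.
apply: le_trans (lerD top_le bottom_le) _.
have mono : 2 * y / (1 + 2 * y) <= t%:R * a / (1 + t%:R * a).
  have yta : 2 * y <= t%:R * a.
    have -> : 2 * y = t%:R * b by rewrite /y; field.
    by rewrite ler_pM2l// ltW.
  rewrite ler_pdivrMr ?ltr_wpDr ?mulr_ge0//; last lra.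
  rewrite mulrAC ler_pdivlMr; last by lra.
  lra.
have L14 : 0 <= 14 * L / t%:R by rewrite !mulr_ge0// invr_ge0 ltW.
apply: le_trans (ler_wpM2l L14 mono).
(* Since b = 2y/t, the top part is at most (2L/t) y e^(-y) <= (14L/t)(G(2y) - G(y)); the term G(y)
   cancels against the bound for the bottom part. *)
have L2 : 0 <= 2 * L / t%:R by rewrite !mulr_ge0// invr_ge0 ltW.
have := ler_wpM2l L2 (mul_expRN_telescope y0).
have -> : b = 2 * y / t%:R by rewrite /y; field; rewrite gt_eqF.
have -> : L * (2 * y / t%:R * expR (- y)) = 2 * L / t%:R * (y * expR (- y)).
  by ring.
lra.
Qed.

(** * The expected missing mass as a series over atoms *)

Section expected_missing_mass.
Context (d d' : measure_display) (Omega : measurableType d)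
  (S : measurableType d') (R : realType).
Variables (mu : probability Omega R) (P : probability S R) (t : nat).
Variables (X : 'I_t -> {RV mu >-> S}) (f : S -> nat).
Hypotheses (iidX : iid_sample P X) (f_inj : injective f).
Hypothesis S_discrete : forall A : set S, measurable A.
Local Open Scope ereal_scope.

(* S is numbered by f: each atom is a singleton or empty. *)
Let atom k : set S := f @^-1` [set k].
Let q k : R := fine (P (atom k)).
(** Indexed by the full finite set, so that the product rule of [mutually_independent] applies
    directly. *)
Let miss k : set Omega := \bigcap_(i in [set` [set: 'I_t]%SET]) (X i @^-1` ~` atom k).

Lemma measurable_miss k : measurable (miss k).
Proof.
by apply: fin_bigcap_measurable => // i _; exact: measurable_funPTI.
Qed.

Lemma probability_miss k : mu (miss k) = ((1 - q k) ^+ t)%:E.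
Proof.
have [indep distX] := iidX.
rewrite indep// (eq_bigr (fun=> (1 - q k)%:E)).
  by rewrite prodEFin prodr_const cardsT card_ord.
move=> i _; have := distX i (~` atom k) (S_discrete _).
rewrite /distribution /pushforward => ->.
by rewrite probability_setC// EFinB fineK ?fin_num_measure.
Qed.

Lemma measure_atoms (B : set S) : P B = \sum_(k <oo) P (B `&` atom k).
Proof.
have {1}-> : B = \bigcup_k (B `&` atom k).
  by rewrite -setI_bigcupr -preimage_bigcup bigcup_imset1 image_id setIT.
rewrite measure_semi_bigcup//.
apply/trivIsetP => i j _ _ ij; rewrite setIACA -classical_sets.subset0.
by move=> s [_ [/= fi fj]]; move: ij; rewrite -fi -fj eqxx.
Qed.

Lemma missing_mass_series w :
  (missing_mass P X w)%:E =
  \sum_(k <oo) (q k)%:E * (\1_(miss k) w)%:E.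
Proof.
rewrite /missing_mass fineK ?fin_num_measure//.
rewrite measure_atoms.
set B := ~` _.
apply: eq_eseriesr => k _; rewrite fineK ?fin_num_measure//.
rewrite indicE; have [missw|nmiss] := boolP (w \in miss k).
  rewrite mule1; congr (P _); apply/seteqP; split=> [s []//|s sk].
  split=> // -[i _ Xis]; move: missw; rewrite inE => /(_ i).
  by rewrite /= finset.in_setT => /(_ isT); apply; rewrite /atom/= Xis.
(* By injectivity of [f], an atom that has been hit consists of the sampled point alone, so nothing
   of it is missing. *)
rewrite mule0 (_ : _ `&` _ = set0) ?measure0//.
rewrite -classical_sets.subset0 => s [Bs sk]; move: nmiss; rewrite notin_setE; apply.
move=> i _ /= Xik; apply: Bs; exists i => //.
by apply: f_inj; rewrite sk Xik.
Qed.

(** Nonnegativity of the terms allows exchanging integral and series; each indicator then integrates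
    to the probability of [miss k]. *)
Lemma expectation_missing_mass :
  'E_mu[missing_mass P X] =
  \sum_(k <oo) (q k * (1 - q k) ^+ t)%:E.
Proof.
rewrite unlock.
under eq_integral do rewrite missing_mass_series.
have ge0 k w : 0 <= (\1_(miss k) w : R)%:E by rewrite lee_fin.
rewrite integral_nneseries//; last 2 first.
- move=> k; apply: emeasurable_funM; first exact: measurable_cst.
  by apply/measurable_EFinP/measurable_indic; exact: measurable_miss.
- by move=> k w _; rewrite mule_ge0// lee_fin fine_ge0.
apply: eq_eseriesr => k _.
rewrite ge0_integralZl//; last 2 first.
- by apply/measurable_EFinP/measurable_indic; exact: measurable_miss.
- by rewrite lee_fin fine_ge0.
rewrite integral_indic//; last exact: measurable_miss.
by rewrite setIT EFinM; congr (_ * _); exact: probability_miss.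
Qed.

Lemma atom_ge0_le1 k : (0 <= q k <= 1)%R.
Proof.
rewrite fine_ge0//= -lee_fin fineK ?fin_num_measure//.
exact: probability_le1.
Qed.

Let term_ge0 k : 0 <= (q k * (1 - q k) ^+ t)%:E.
Proof.
have /andP[q0 q1] := atom_ge0_le1 k.
by rewrite lee_fin mulr_ge0// exprn_ge0// subr_ge0.
Qed.

(** Reduces a countable [S] to finite index sets, where [dyadic_sum_le] applies. *)
Lemma expectation_missing_mass_le M :
  (forall N, (\sum_(k < N) q k * (1 - q k) ^+ t <= M)%R) ->
  'E_mu[missing_mass P X] <= M%:E.
Proof.
move=> sum_le; rewrite expectation_missing_mass; apply: lime_le.
  exact: is_cvg_nneseries.
by apply: nearW => N; rewrite big_mkord sumEFin lee_fin.
Qed.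

Section finite_support.
Variable N : nat.
Hypothesis f_lt : forall s, (f s < N)%N.

Let P_atom0 k : (N <= k)%N -> P (atom k) = 0.
Proof.
move=> Nk; rewrite (_ : atom k = set0) ?measure0//.
rewrite -classical_sets.subset0 => s /= sk.
by move: (f_lt s); rewrite sk ltnNge Nk.
Qed.

Lemma expectation_missing_mass_finite :
  'E_mu[missing_mass P X] = (\sum_(k < N) q k * (1 - q k) ^+ t)%:E.
Proof.
rewrite expectation_missing_mass (nneseries_split 0 N)//.
rewrite [X in _ + X]eseries0 ?adde0; last first.
  by move=> k Nk _; rewrite /q P_atom0// mul0r.
by rewrite add0n big_mkord sumEFin.
Qed.

Lemma sum_atoms : (\sum_(k < N) q k = 1)%R.
Proof.
apply: EFin_inj; rewrite -sumEFin.
transitivity (P setT); last exact: probability_setT.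
rewrite measure_atoms (nneseries_split 0 N)//.
rewrite [X in _ + X]eseries0 ?adde0; last first.
  by move=> k Nk _; rewrite setTI P_atom0.
rewrite add0n big_mkord; apply: eq_bigr => i _.
by rewrite setTI fineK ?fin_num_measure.
Qed.

End finite_support.

End expected_missing_mass.

(** * Plateau length and the final bounds *)

(** Truncating to indices below [N] can only lower the count of a scale, and an infinite scale
    counts as +oo. *)
Lemma plateau_length_ge (R : realType) (P : probability nat R) (N : nat) (a : R) :
  0 < a < 1 ->
  (#|[pred i : 'I_N | a / 2 <= fine (P [set (i : nat)]) < a]|%:R%:E
     <= plateau_length P)%E.
Proof.
move=> a01.
set A := [set i : nat | ((a / 2)%:E <= P [set i] < a%:E)%E].
apply: (@le_trans _ _ (counting A)); last first.
  by apply: ereal_sup_ubound; exists a.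
rewrite /counting; case: ifPn => [/asboolP finA|_]; last exact: leey.
rewrite lee_fin ler_nat cardE -(size_map val).
apply: uniq_leq_size; first by rewrite map_inj_uniq ?enum_uniq//; exact: val_inj.
move=> k /mapP[i]; rewrite mem_enum => /andP[pa1 pa2] ->.
rewrite in_fset_set// inE /A/= -(fineK (fin_num_measure P [set (i : nat)] _))//.
by rewrite lee_fin lte_fin pa1.
Qed.

Theorem theorem1 (R : realType) :
  (forall (n : nat) (P : probability 'I_n.+1 R) (t : nat), (1 <= t)%N ->
     forall (d : measure_display) (Omega : measurableType d)
       (mu : probability Omega R) (X : 'I_t -> {RV mu >-> 'I_n.+1}),
     iid_sample P X ->
     ('E_mu[missing_mass P X] <=
       (if (t <= n.+1)%N then expR (- (t%:R / n.+1%:R))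
        else n.+1%:R / (expR 1 * t%:R))%:E)%E) /\
  (exists c : R, 0 < c /\
     forall (P : probability nat R) (t : nat), (1 <= t)%N ->
     forall (d : measure_display) (Omega : measurableType d)
       (mu : probability Omega R) (X : 'I_t -> {RV mu >-> nat}),
     iid_sample P X ->
     ('E_mu[missing_mass P X] <= plateau_length P / (c * t%:R)%:E)%E).
Proof.
split=> [n P t t0 d Omega mu X iidX|].
  have mS (A : set 'I_n.+1) : measurable A by [].
  rewrite (expectation_missing_mass_finite iidX (@ord_inj n.+1) mS (@ltn_ord n.+1)).
  rewrite lee_fin; apply: sum_missing_le => // [i|].
    exact: atom_ge0_le1.
  exact: (sum_atoms P mS (@ltn_ord n.+1)).
(* The constant 14 comes from [dyadic_sum_le] at a = 1, where G(t) <= 1. *)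
exists 14^-1; split=> [|P t t0 d Omega mu X iidX]; first by rewrite invr_gt0.
have mS (A : set nat) : measurable A by [].
have tR0 : (0 : R) < t%:R by rewrite ltr0n.
have ct0 : 0 < 14^-1 * t%:R :> R by rewrite mulr_gt0.
rewrite inver gt_eqF//.
have := @plateau_length_ge R P.
case: (plateau_length P) => [L|_|]; last 2 first.
- by rewrite gt0_mulye ?lte_fin ?invr_gt0// leey.
(* The value -oo is excluded because any single scale has a count of at least 0. *)
- by move=> /(_ 0 (1 / 2)); rewrite leeNy_eq => h; have: false by apply: h; lra.
move=> plateau; rewrite -EFinM.
apply: (expectation_missing_mass_le iidX (@inj_id nat) mS) => N.
set p := fun i : 'I_N => fine (P [set (i : nat)]).
have : \sum_(i | 0 < p i < 1) p i * (1 - p i) ^+ t <=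
    14 * L / t%:R * (t%:R * 1 / (1 + t%:R * 1)).
  apply: dyadic_sum_le => //; last lra.
  by move=> a a01; rewrite -lee_fin; exact: plateau.
have L0 : 0 <= L.
  have /(_ 0 (1 / 2)) := plateau; rewrite lee_fin => h.
  by apply: le_trans (h _); rewrite ?ler0n//; lra.
have G1 : t%:R * 1 / (1 + t%:R * 1) <= 1 :> R.
  by rewrite mulr1 ler_pdivrMr ?mul1r; lra.
have L14 : 0 <= 14 * L / t%:R by rewrite !mulr_ge0// invr_ge0 ltW.
move=> /le_trans /(_ (ler_wpM2l L14 G1)).
rewrite mulr1 invfM invrK mulrA (mulrC L).
apply: le_trans; rewrite le_eqVlt; apply/orP; left; apply/eqP.
(* The indices outside 0 < p < 1 contribute nothing: p = 0 kills the first factor, and p = 1 the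
   power, as t >= 1. *)
rewrite [RHS]big_mkcond/=; apply: eq_bigr => i _.
have /andP[p0 p1] := atom_ge0_le1 P id mS i.
rewrite -/(p i) in p0 p1 *.
case: ifPn => //; rewrite negb_and -!leNgt => /orP[pi0|pi1].
  by have -> : p i = 0; [lra|rewrite mul0r].
by have -> : p i = 1; [lra|rewrite subrr expr0n gtn_eqF// mulr0].
Qed.
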